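(* Let $p,r,m$ be positive integers and let $A:\mathbb{R}^{p\times p}\to\mathbb{R}^m$ be a linear map satisfying, for some $\gamma\in[0,1)$, the RIP $$(1-\gamma)\|X\|_F^2\le\|A(X)\|_2^2\le(1+\gamma)\|X\|_F^2$$ for all symmetric matrices $X\in\mathbb{R}^{p\times p}$ of rank at most $2r$. Let $y=A(x_0)$ where $x_0$ is a positive semi-definite matrix of rank at most $r$ (noiseless case), let $g(Z)=\|A(ZZ^T)-y\|_2^2$ for $Z\in\mathbb{R}^{p\times r}$, and let $Z_0\in\mathbb{R}^{p\times r}$ be a global minimizer of $g$ over $\mathbb{R}^{p\times r}$ having rank $r$. Let $$\beta_{LR}:=\frac18\,\frac{(1-\gamma)\,(\sigma_{\min}(Z_0))^2}{(1+\gamma)\,\sigma_{\max}(Z_0)}.$$ Then $\Lambda_{\beta_{LR}}:=\{Z\in\mathbb{R}^{p\times r}:\inf_{H\in\mathcal{O}(r)}\|ZH-Z_0\|_F<\beta_{LR}\}$ is a $g$-basin of attraction of $Z_0$.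
   Context: $\|\cdot\|_F$ is the Frobenius norm, $\mathcal{O}(r)$ the group of $r\times r$ orthogonal matrices. $\sigma_{\max}(Z_0)$ and $\sigma_{\min}(Z_0)$ are the largest and the $r$-th (smallest) singular values of the rank-$r$ matrix $Z_0\in\mathbb{R}^{p\times r}$. A set $\Lambda\subset\mathbb{R}^{p\times r}$ with $Z_0\in\Lambda$ is a $g$-basin of attraction of $Z_0$ if there exists $\tau_0>0$ such that for any $\tau\in(0,\tau_0]$ and any initialization in $\Lambda$, the gradient descent sequence $Z_{(n+1)}=Z_{(n)}-\tau\nabla g(Z_{(n)})$ satisfies $g(Z_{(n)})\to g(Z_0)$ as $n\to\infty$. *)

(* Defs.v *)
From HB Require Import structures.
From mathcomp Require Import all_boot all_order all_algebra.
From mathcomp Require Import boolp classical_sets reals topology normedtype.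
From mathcomp Require Import derive.

Set Implicit Arguments.
Unset Strict Implicit.
Unset Printing Implicit Defensive.

Import Order.TTheory GRing.Theory Num.Theory.
Import numFieldNormedType.Exports.

Local Open Scope classical_set_scope.
Local Open Scope ring_scope.

(* MathComp-Analysis' own norm `|X| on matrices is the max norm.  On column
   vectors the Frobenius norm is the Euclidean norm. *)
Definition frobnorm (R : realType) (m n : nat) (X : 'M[R]_(m, n)) : R :=
  Num.sqrt (\sum_(i < m) \sum_(j < n) X i j ^+ 2).

Definition psdmx (R : realType) (n : nat) (X : 'M[R]_n) : Prop :=
  X^T = X /\ forall v : 'cV[R]_n, 0 <= (v^T *m X *m v) 0 0.

Definition orthogonal_group (R : realType) (n : nat) : set 'M[R]_n :=
  [set H | H^T *m H = 1%:M].

(* For n <= m (in particular for Z of rank n) these are the n singular values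
   of Z; for m < n the spurious value 0, from the kernel of Z, would appear. *)
Definition singular_values (R : realType) (m n : nat) (Z : 'M[R]_(m, n)) :
    set R :=
  [set s | 0 <= s /\ eigenvalue (Z^T *m Z) (s ^+ 2)].

(* When 0 < n, the set of singular values is finite and nonempty, so sup and inf
   are its maximum and its minimum. *)
Definition sigma_max (R : realType) (m n : nat) (Z : 'M[R]_(m, n)) : R :=
  sup (singular_values Z).

Definition sigma_min (R : realType) (m n : nat) (Z : 'M[R]_(m, n)) : R :=
  inf (singular_values Z).

Definition rip (R : realType) (p m : nat) (A : 'M[R]_p -> 'cV[R]_m)
    (gamma : R) (k : nat) : Prop :=
  forall X : 'M[R]_p, X^T = X -> (\rank X <= k)%N ->
    (1 - gamma) * frobnorm X ^+ 2 <= frobnorm (A X) ^+ 2 /\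
    frobnorm (A X) ^+ 2 <= (1 + gamma) * frobnorm X ^+ 2.

Definition lr_objective (R : realType) (p r m : nat)
    (A : 'M[R]_p -> 'cV[R]_m) (y : 'cV[R]_m) (Z : 'M[R]_(p, r)) : R :=
  frobnorm (A (Z *m Z^T) - y) ^+ 2.

(* Gradient for the Frobenius inner product: the matrix of the partial
   derivatives of g with respect to the entries. *)
Definition gradient (R : realType) (p r : nat) (g : 'M[R]_(p, r) -> R)
    (Z : 'M[R]_(p, r)) : 'M[R]_(p, r) :=
  \matrix_(i < p, j < r) 'D_(delta_mx i j) g Z.

Definition gd_step (R : realType) (p r : nat) (g : 'M[R]_(p, r) -> R)
    (tau : R) (Z : 'M[R]_(p, r)) : 'M[R]_(p, r) :=
  Z - tau *: gradient g Z.

Definition basin_of_attraction (R : realType) (p r : nat)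
    (g : 'M[R]_(p, r) -> R) (Z0 : 'M[R]_(p, r)) (L : set 'M[R]_(p, r)) : Prop :=
  L Z0 /\
  exists tau0 : R, 0 < tau0 /\
    forall tau : R, 0 < tau -> tau <= tau0 ->
    forall Zinit : 'M[R]_(p, r), L Zinit ->
      (fun n : nat => g (iter n (gd_step g tau) Zinit)) @ \oo --> g Z0.

Definition orbit_dist (R : realType) (p r : nat) (Z Z0 : 'M[R]_(p, r)) : R :=
  inf [set frobnorm (Z *m H - Z0) | H in @orthogonal_group R r].

Definition orbit_ball (R : realType) (p r : nat) (Z0 : 'M[R]_(p, r))
    (beta : R) : set 'M[R]_(p, r) :=
  [set Z | orbit_dist Z Z0 < beta].

Definition beta_LR (R : realType) (p r : nat) (gamma : R)
    (Z0 : 'M[R]_(p, r)) : R :=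
  1 / 8 * ((1 - gamma) * sigma_min Z0 ^+ 2 / ((1 + gamma) * sigma_max Z0)).

(* Main.v *)
(* Since [g] vanishes at [Z0], RIP gives [x0 = Z0 Z0^T].  Write
   [D = Z Z^T - Z0 Z0^T], so that [g Z = |A D|^2] is comparable to [|D|^2], and
   [s] for the least singular value of [Z0].  The ball of radius [beta_LR] lies in a
   sublevel set of [g] on which [|D| <= s^2 / 2].  On that set [g] satisfies a
   Polyak-Lojasiewicz inequality [mu g <= |grad g|^2]: some direction [E] has
   [Z E^T + E Z^T = D + N] with [|N| <= |D|^2 / s^2], so that
   [<grad g, E> = 2 <A D, A D + A N> >= g], while [|E| = O(|D|)].  For small
   [tau] each step decreases [g] by at least [tau / 2 |grad g|^2], hence the
   sublevel set is invariant and [g] decays geometrically along the iterates.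
   No optimal alignment of [Z] with the orbit of [Z0] is needed. *)
Require Import Defs.
From HB Require Import structures.
From mathcomp Require Import all_boot all_order all_algebra.
From mathcomp Require Import boolp classical_sets reals topology normedtype.
From mathcomp Require Import sequences derive ring lra.

Import Order.TTheory GRing.Theory Num.Theory.
Import numFieldNormedType.Exports.

Local Open Scope ring_scope.
Set Implicit Arguments.
Unset Strict Implicit.
Unset Printing Implicit Defensive.

(** * The Frobenius inner product and norm *)

Section Frobenius.
Variable R : realType.

Definition fdot m n (X Y : 'M[R]_(m, n)) : R := \tr (X^T *m Y).

Lemma fdotE m n (X Y : 'M[R]_(m, n)) :
  fdot X Y = \sum_(i < m) \sum_(j < n) X i j * Y i j.
Proof.
rewrite /fdot /mxtrace exchange_big /=; apply: eq_bigr => j _.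
by rewrite mxE; apply: eq_bigr => i _; rewrite mxE.
Qed.

Lemma fdotC m n (X Y : 'M[R]_(m, n)) : fdot X Y = fdot Y X.
Proof. by rewrite /fdot -mxtrace_tr trmx_mul trmxK. Qed.

Lemma fdotDr m n (X Y Z : 'M[R]_(m, n)) : fdot X (Y + Z) = fdot X Y + fdot X Z.
Proof. by rewrite /fdot mulmxDr mxtraceD. Qed.

Lemma fdotZr m n a (X Y : 'M[R]_(m, n)) : fdot X (a *: Y) = a * fdot X Y.
Proof. by rewrite /fdot -scalemxAr mxtraceZ. Qed.

Lemma fdotNr m n (X Y : 'M[R]_(m, n)) : fdot X (- Y) = - fdot X Y.
Proof. by rewrite -scaleN1r fdotZr mulN1r. Qed.

Lemma fdotDl m n (X Y Z : 'M[R]_(m, n)) : fdot (X + Y) Z = fdot X Z + fdot Y Z.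
Proof. by rewrite fdotC fdotDr !(fdotC Z). Qed.

Lemma fdotZl m n a (X Y : 'M[R]_(m, n)) : fdot (a *: X) Y = a * fdot X Y.
Proof. by rewrite fdotC fdotZr fdotC. Qed.

Lemma fdotNl m n (X Y : 'M[R]_(m, n)) : fdot (- X) Y = - fdot X Y.
Proof. by rewrite fdotC fdotNr fdotC. Qed.

Lemma fdot_tr m n (X Y : 'M[R]_(m, n)) : fdot X^T Y^T = fdot X Y.
Proof. by rewrite fdotC /fdot trmxK mxtrace_mulC. Qed.

Lemma fdot_mull m n p (X : 'M[R]_(m, n)) (Y : 'M_(n, p)) Z :
  fdot (X *m Y) Z = fdot Y (X^T *m Z).
Proof. by rewrite /fdot trmx_mul mulmxA. Qed.

Lemma frobnorm_sqr m n (X : 'M[R]_(m, n)) : frobnorm X ^+ 2 = fdot X X.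
Proof.
rewrite /frobnorm sqr_sqrtr ?fdotE; last first.
  by apply: sumr_ge0 => i _; apply: sumr_ge0 => j _; exact: sqr_ge0.
by apply: eq_bigr => i _; apply: eq_bigr.
Qed.

Lemma frobnorm_ge0 m n (X : 'M[R]_(m, n)) : 0 <= frobnorm X.
Proof. exact: sqrtr_ge0. Qed.

Lemma fdot_ge0 m n (X : 'M[R]_(m, n)) : 0 <= fdot X X.
Proof. by rewrite -frobnorm_sqr sqr_ge0. Qed.

Lemma fdot_eq0 m n (X : 'M[R]_(m, n)) : fdot X X = 0 -> X = 0.
Proof.
rewrite fdotE => /eqP; rewrite psumr_eq0; last first.
  by move=> i _; apply: sumr_ge0 => j _; rewrite -expr2 sqr_ge0.
move=> /allP X0; apply/matrixP => i j; rewrite mxE.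
have := X0 i (mem_index_enum _); rewrite /= psumr_eq0; last first.
  by move=> k _; rewrite -expr2 sqr_ge0.
by move=> /allP /(_ j (mem_index_enum _)) /=; rewrite mulf_eq0 orbb => /eqP.
Qed.

Lemma fdot_gt0 m n (X : 'M[R]_(m, n)) : X != 0 -> 0 < fdot X X.
Proof.
by move=> X0; rewrite lt0r fdot_ge0 andbT; apply: contra X0 => /eqP/fdot_eq0->.
Qed.

(** Cauchy-Schwarz: the squared norm of [fdot Y Y *: X - fdot X Y *: Y] is [fdot Y Y] times the
    difference of the two sides. *)
Lemma fdot_sqr_le m n (X Y : 'M[R]_(m, n)) :
  fdot X Y ^+ 2 <= fdot X X * fdot Y Y.
Proof.
have [->|Y0] := eqVneq Y 0.
  by rewrite /fdot !mulmx0 mxtrace0 expr0n mulr0.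
have Ygt0 := fdot_gt0 Y0.
have := fdot_ge0 (fdot Y Y *: X - fdot X Y *: Y).
rewrite !(fdotDl, fdotDr, fdotNl, fdotNr, fdotZl, fdotZr) (fdotC Y X).
move=> h.
rewrite -subr_ge0 -(pmulr_rge0 _ Ygt0).
by move: h; set a := fdot _ _; set b := fdot _ _; set c := fdot _ _; nra.
Qed.

Lemma fdot_le m n (X Y : 'M[R]_(m, n)) : fdot X Y <= frobnorm X * frobnorm Y.
Proof.
apply: le_trans (ler_norm _) _.
rewrite -(@ler_pXn2r _ 2) ?nnegrE ?mulr_ge0 ?frobnorm_ge0 //.
by rewrite real_normK ?num_real // exprMn !frobnorm_sqr fdot_sqr_le.
Qed.

Lemma frobnormN m n (X : 'M[R]_(m, n)) : frobnorm (- X) = frobnorm X.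
Proof.
by rewrite /frobnorm; congr Num.sqrt; apply: eq_bigr => i _; apply: eq_bigr => j _;
   rewrite mxE sqrrN.
Qed.

Lemma frobnorm_tr m n (X : 'M[R]_(m, n)) : frobnorm X^T = frobnorm X.
Proof.
apply/eqP; rewrite -(@eqrXn2 _ 2) ?frobnorm_ge0 //.
by rewrite !frobnorm_sqr fdot_tr.
Qed.

Lemma frobnormZ m n a (X : 'M[R]_(m, n)) : 0 <= a -> frobnorm (a *: X) = a * frobnorm X.
Proof.
move=> a0; apply/eqP; rewrite -(@eqrXn2 _ 2) ?mulr_ge0 ?frobnorm_ge0 //.
by rewrite exprMn !frobnorm_sqr fdotZl fdotZr mulrA -expr2.
Qed.

Lemma frobnorm_le m n (X : 'M[R]_(m, n)) a :
  0 <= a -> fdot X X <= a ^+ 2 -> frobnorm X <= a.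
Proof.
by move=> a0 h; rewrite -(@ler_pXn2r _ 2) ?nnegrE ?frobnorm_ge0 // frobnorm_sqr.
Qed.

Lemma frobnormD m n (X Y : 'M[R]_(m, n)) :
  frobnorm (X + Y) <= frobnorm X + frobnorm Y.
Proof.
apply: frobnorm_le; first by rewrite addr_ge0 ?frobnorm_ge0.
rewrite fdotDl !fdotDr (fdotC Y X).
have := fdot_le X Y; have := frobnorm_sqr X; have := frobnorm_sqr Y.
by set a := fdot _ _; set b := fdot _ _; set c := fdot _ _; nra.
Qed.

(** Cauchy-Schwarz for each row of [X] against each column of [Y], summed over the entries. *)
Lemma frobnormM m n p (X : 'M[R]_(m, n)) (Y : 'M[R]_(n, p)) :
  frobnorm (X *m Y) <= frobnorm X * frobnorm Y.
Proof.
apply: frobnorm_le; first by rewrite mulr_ge0 ?frobnorm_ge0.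
rewrite exprMn !frobnorm_sqr -[fdot Y Y]fdot_tr !fdotE mulr_suml.
apply: ler_sum => i _; rewrite mulr_sumr; apply: ler_sum => j _.
have := fdot_sqr_le (row i X) (row j Y^T).
rewrite !fdotE !big_ord1.
under eq_bigr => k _ do rewrite !mxE.
under [X in _ <= X * _]eq_bigr => k _ do rewrite !mxE.
under [X in _ <= _ * X]eq_bigr => k _ do rewrite !mxE.
rewrite -expr2 mxE => h; apply: le_trans h _.
apply: ler_wpM2l; first by apply: sumr_ge0 => k _; rewrite -expr2 sqr_ge0.
by apply: ler_sum => k _; rewrite !mxE.
Qed.

End Frobenius.

(** * Positive semi-definite matrices and extreme singular values *)

Section Spectral.
Variable R : realType.

Lemma fdot_delta n (X : 'M[R]_n) i j :
  fdot (delta_mx i 0 : 'cV_n) (X *m delta_mx j 0) = X i j.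
Proof.
by rewrite /fdot trmx_delta mulmxA -rowE /mxtrace big_ord1 -colE !mxE.
Qed.

Lemma fdot_mulC n (X : 'M[R]_n) (u v : 'cV_n) :
  X^T = X -> fdot u (X *m v) = fdot v (X *m u).
Proof. by move=> XT; rewrite fdotC fdot_mull XT. Qed.

Lemma psdmxP n (X : 'M[R]_n) :
  psdmx X <-> X^T = X /\ forall v : 'cV_n, 0 <= fdot v (X *m v).
Proof.
have e (v : 'cV[R]_n) : fdot v (X *m v) = (v^T *m X *m v) 0 0.
  by rewrite /fdot mulmxA /mxtrace big_ord1.
by split=> -[XT Xge0]; split=> // v; have := Xge0 v; rewrite e.
Qed.

(** Without a positive diagonal entry the diagonal vanishes; the form at [e_i - X i j e_j] is then
    [-2 (X i j)^2], which forces [X i j = 0]. *)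
Lemma psdmx_diag_gt0 n (X : 'M[R]_n) :
  psdmx X -> X != 0 -> exists i, 0 < X i i.
Proof.
move=> /psdmxP[XT Xge0] X0; apply: contrapT => noi.
have Xii i : X i i = 0.
  apply/eqP; rewrite eq_le -{2}fdot_delta Xge0 andbT leNgt.
  by apply/negP => Xi; apply: noi; exists i.
case/eqP: X0; apply/matrixP => i j; rewrite mxE.
have := Xge0 (delta_mx i 0 - X i j *: delta_mx j 0).
rewrite mulmxBr -scalemxAr !(fdotDl, fdotDr, fdotNl, fdotNr, fdotZl, fdotZr).
have Xji : X j i = X i j by rewrite -{1}XT mxE.
rewrite !fdot_delta !Xii Xji.
by move=> h; apply/eqP; rewrite -sqrf_eq0; apply/eqP; nra.
Qed.

(* One step of the Cholesky factorization: eliminating a positive diagonal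
   entry lowers the rank. *)
Lemma psdmx_elim n (X : 'M[R]_n) i (x := col i X) :
  psdmx X -> 0 < X i i ->
  psdmx (X - (X i i)^-1 *: (x *m x^T)) /\
  (\rank (X - (X i i)^-1 *: (x *m x^T))%R < \rank X)%N.
Proof.
move=> /psdmxP[XT Xge0] Xi; set a := X i i in Xi *; set X' := X - _.
have a0 : a != 0 by rewrite gt_eqF.
have xE : x = X *m delta_mx i 0 by rewrite /x colE.
split.
  apply/psdmxP; split.
    by rewrite /X' linearB linearZ /= trmx_mul trmxK XT.
  (* This shift minimizes the form of [X] on the line [v + R e_i]; the minimum is the form of [X']
     at [v]. *)
  move=> v; have := Xge0 (v - (a^-1 * fdot v x) *: delta_mx i 0).
  rewrite mulmxBr -scalemxAr !(fdotDl, fdotDr, fdotNl, fdotNr, fdotZl, fdotZr).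
  rewrite (fdot_mulC (delta_mx i 0) v) // fdot_delta -/a -xE.
  rewrite /X' mulmxBl fdotDr fdotNr -scalemxAl fdotZr -mulmxA.
  have -> : fdot v (x *m (x^T *m v)) = fdot v x ^+ 2.
    rewrite [x^T *m v]mx11_scalar mul_mx_scalar fdotZr expr2.
    by rewrite (fdotC v x) {2}/fdot /mxtrace big_ord1.
  suff -> : a^-1 * fdot v x * (a^-1 * fdot v x * a) = a^-1 * fdot v x ^+ 2.
    by move=> h; nra.
  by field.
(* [X'] is a left multiple of [X], so its row space lies in that of [X], strictly because [X'] kills
   [e_i] and [X] does not. *)
have X'E : X' = (1%:M - a^-1 *: (x *m (delta_mx i 0)^T)) *m X.
  rewrite mulmxBl mul1mx -scalemxAl -mulmxA /X'; congr (_ - _ *: (_ *m _)).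
  by rewrite xE trmx_mul XT.
have X'e : X' *m (delta_mx i 0 : 'cV_n) = 0.
  rewrite /X' mulmxBl -scalemxAl -mulmxA -xE.
  have -> : x^T *m (delta_mx i 0 : 'cV_n) = a%:M.
    by rewrite -colE [LHS]mx11_scalar !mxE.
  by rewrite mul_mx_scalar scalerA mulVf // scale1r subrr.
apply: rank_ltmx; rewrite /ltmx {1}X'E submxMl /=.
apply/negP => /submxP[D XD].
have : (X *m (delta_mx i 0 : 'cV_n)) i 0 = 0.
  by rewrite XD -mulmxA X'e mulmx0 mxE.
by rewrite -xE mxE => /eqP; apply/negP.
Qed.

(** Cholesky by induction on [k]: the pivot column, divided by the square root of the pivot, becomes
    the first column of the factor. *)
Lemma psdmx_factor k n (X : 'M[R]_n) :
  psdmx X -> (\rank X <= k)%N -> exists W : 'M[R]_(n, k), X = W *m W^T.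
Proof.
elim: k X => [|k IHk] X Xpsd.
  by rewrite leqn0 mxrank_eq0 => /eqP->; exists 0; rewrite mul0mx.
move=> Xk; have [->|X0] := eqVneq X 0; first by exists 0; rewrite mul0mx.
have [i Xi] := psdmx_diag_gt0 Xpsd X0.
have [X'psd X'k] := psdmx_elim Xpsd Xi.
have [W XW] := IHk _ X'psd (leq_trans X'k Xk).
pose V : 'M[R]_(n, 1 + k) := row_mx (Num.sqrt (X i i)^-1 *: col i X) W.
exists V; suff : X = V *m V^T by [].
rewrite tr_row_mx mul_row_col -XW linearZ /= -scalemxAl -scalemxAr scalerA.
by rewrite -expr2 sqr_sqrtr ?invr_ge0 ?ltW // addrC subrK.
Qed.

Lemma fdot_col m n (X Y : 'M[R]_(m, n)) :
  fdot X Y = \sum_j fdot (col j X) (col j Y).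
Proof.
rewrite fdotE exchange_big; apply: eq_bigr => j _; rewrite fdotE.
by apply: eq_bigr => i _; rewrite big_ord1 !mxE.
Qed.

Lemma psdmx_fdot_ge0 n k (X : 'M[R]_n) (V : 'M[R]_(n, k)) :
  psdmx X -> 0 <= fdot V (X *m V).
Proof.
move=> /psdmxP[_ Xge0]; rewrite fdot_col; apply: sumr_ge0 => j _.
by rewrite [col j (_ *m _)]colE -mulmxA -colE.
Qed.

(* The supremum [l] of the [t] such that [T - t I] is psd is an eigenvalue:
   otherwise the Cholesky factor of [T - l I] is invertible, so that [T - l I]
   is bounded below by a positive multiple of [I]. *)
Lemma min_eigenvalue n (T : 'M[R]_n) :
  (0 < n)%N -> T^T = T -> exists2 l, eigenvalue T l & psdmx (T - l%:M).
Proof.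
case: n T => // n T _ TT.
pose S := [set t | psdmx (T - t%:M)]%classic.
have SE t : S t <-> forall v : 'cV_n.+1, t * fdot v v <= fdot v (T *m v).
  rewrite /S /= psdmxP linearB /= tr_scalar_mx TT; split=> [[_ h] v|h].
    have := h v.
    by rewrite mulmxBl mul_scalar_mx fdotDr fdotNr fdotZr subr_ge0.
  split=> // v.
  by rewrite mulmxBl mul_scalar_mx fdotDr fdotNr fdotZr subr_ge0.
(* Cauchy-Schwarz puts [- frobnorm T] in [S]; the form at a basis vector bounds [S] above. *)
have supS : has_sup S.
  split.
    exists (- frobnorm T); apply/SE => v.
    rewrite mulNr lerNl -fdotNr; apply: le_trans (fdot_le _ _) _.
    rewrite frobnormN -frobnorm_sqr.
    have := frobnormM T v; have := frobnorm_ge0 v.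
    by set a := frobnorm (_ *m _); set b := frobnorm v; nra.
  exists (T ord0 ord0) => t /SE /(_ (delta_mx ord0 0)).
  rewrite fdot_delta -[X in fdot _ X]mul1mx fdot_delta mxE eqxx mulr1.
  exact.
have Sl : S (sup S).
  apply/SE => v; have [->|v0] := eqVneq v 0.
    by rewrite /fdot mulmx0 !mulmx0 mxtrace0 mulr0.
  rewrite -ler_pdivlMr ?fdot_gt0 //; apply: ge_sup; first exact: supS.1.
  by move=> t /SE /(_ v); rewrite ler_pdivlMr ?fdot_gt0.
exists (sup S) => //; rewrite /eigenvalue /eigenspace kermx_eq0 row_free_unit.
apply/negP => Tu.
have [W WE] := psdmx_factor Sl (rank_leq_row _).
move: Tu; rewrite WE unitmx_mul => /andP[_ Wu].
(* As [|v| <= C |W^T v|], the form of [T - sup S] is at least [C^-2 |v|^2], so [S] would have a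
   member above its supremum. The [+ 1] makes [C] positive. *)
pose C := frobnorm (invmx W^T) + 1.
have C0 : 0 < C by rewrite ltr_wpDl ?frobnorm_ge0.
have : S (sup S + C ^- 2).
  apply/SE => v; rewrite mulrDl -lerBrDl.
  have -> : fdot v (T *m v) - sup S * fdot v v = frobnorm (W^T *m v) ^+ 2.
    rewrite frobnorm_sqr fdot_mull trmxK mulmxA -WE mulmxBl mul_scalar_mx.
    by rewrite fdotDr fdotNr fdotZr.
  rewrite -frobnorm_sqr mulrC ler_pdivrMr ?exprn_gt0 // -exprMn.
  rewrite ler_pXn2r ?nnegrE ?mulr_ge0 ?frobnorm_ge0 ?(ltW C0) // mulrC.
  rewrite -{1}[v](mulKmx Wu); apply: le_trans (frobnormM _ _) _.
  by rewrite ler_wpM2r ?frobnorm_ge0 // /C lerDl.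
move=> /(ub_le_sup supS.2); rewrite gerDl leNgt.
by rewrite invr_gt0 exprn_gt0.
Qed.

(** If [Z] has full column rank, a kernel vector [v] of the Gram matrix has
    [|Z v|^2 = <v, Z^T Z v> = 0], hence [v = 0]. *)
Lemma gram_unit m n (Z : 'M[R]_(m, n)) :
  (Z^T *m Z \in unitmx) = (\rank Z == n).
Proof.
apply/idP/eqP => [u|rkZ].
  apply/eqP; rewrite eqn_leq rank_leq_col -{1}(mxrank_unit u).
  exact: mxrankM_maxr.
rewrite -row_free_unit -kermx_eq0; apply/eqP.
have fZ : row_free Z^T by rewrite /row_free mxrank_tr rkZ.
have : kermx (Z^T *m Z) *m Z^T = 0.
  rewrite -[LHS]trmxK trmx_mul trmxK; set K := kermx _.
  suff -> : Z *m K^T = 0 by rewrite trmx0.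
  suff h : Z^T *m Z *m K^T = 0.
    by apply: fdot_eq0; rewrite fdot_mull mulmxA h /fdot mulmx0 mxtrace0.
  apply: trmx_inj; rewrite trmx0 trmx_mul trmxK trmx_mul trmxK.
  exact: mulmx_ker.
by rewrite -[X in _ = X](mul0mx _ Z^T); apply: row_free_inj.
Qed.

Lemma eigenvalueN n (T : 'M[R]_n) l : eigenvalue T l -> eigenvalue (- T) (- l).
Proof.
move=> /eigenvalueP[v vT v0]; apply/eigenvalueP; exists v => //.
by rewrite mulmxN vT scaleNr.
Qed.

Lemma singular_value_mem m n (Z : 'M[R]_(m, n)) l :
  eigenvalue (Z^T *m Z) l -> 0 <= l /\ singular_values Z (Num.sqrt l).
Proof.
move=> ev; suff l0 : 0 <= l by split=> //; split; rewrite ?sqrtr_ge0 ?sqr_sqrtr.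
have /eigenvalueP[v vZ v0] := ev.
have : fdot v^T (l *: v^T) = fdot (Z *m v^T) (Z *m v^T).
  by rewrite fdot_mull mulmxA -linearZ /= -vZ trmx_mul trmx_mul trmxK.
rewrite fdotZr => h; have : 0 <= l * fdot v^T v^T by rewrite h fdot_ge0.
by rewrite fdot_tr pmulr_lge0 // fdot_gt0.
Qed.

(** [min_eigenvalue] for [Z^T Z] and for its opposite gives the extreme eigenvalues [l] and [u].
    Their square roots are singular values bounding all others, hence the infimum and the supremum;
    full rank excludes [l = 0]. *)
Lemma singular_values_bounds m n (Z : 'M[R]_(m, n)) (hn : (0 < n)%N) :
  \rank Z = n ->
  [/\ 0 < sigma_min Z, sigma_min Z <= sigma_max Z &
   forall k (V : 'M_(n, k)),
     sigma_min Z ^+ 2 * fdot V V <= fdot (Z *m V) (Z *m V) /\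
     fdot (Z *m V) (Z *m V) <= sigma_max Z ^+ 2 * fdot V V].
Proof.
move=> rkZ; set S := Z^T *m Z.
have ST : S^T = S by rewrite /S trmx_mul trmxK.
have [l evl psdl] := min_eigenvalue hn ST.
have [|u' evu psdu] := min_eigenvalue hn (_ : (- S)^T = - S).
  by rewrite linearN /= ST.
have := eigenvalueN evu; rewrite opprK; set u := - u' => {}evu.
have boundl k (V : 'M_(n, k)) : l * fdot V V <= fdot (Z *m V) (Z *m V).
  have := psdmx_fdot_ge0 V psdl.
  by rewrite mulmxBl mul_scalar_mx fdotDr fdotNr fdotZr subr_ge0 fdot_mull mulmxA.
have boundu k (V : 'M_(n, k)) : fdot (Z *m V) (Z *m V) <= u * fdot V V.
  have := psdmx_fdot_ge0 V psdu.
  rewrite mulmxBl mulNmx mul_scalar_mx fdotDr !fdotNr fdotZr.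
  by rewrite [fdot (Z *m V) _]fdot_mull mulmxA -/S /u; lra.
have evbound s : singular_values Z s ->
    0 <= s /\ Num.sqrt l <= s /\ s <= Num.sqrt u.
  move=> [s0 /eigenvalueP[v vS v0]].
  have vv : 0 < fdot v^T v^T by rewrite fdot_tr fdot_gt0.
  have e : fdot (Z *m v^T) (Z *m v^T) = s ^+ 2 * fdot v^T v^T.
    by rewrite fdot_mull mulmxA -fdotZr -linearZ /= -vS !trmx_mul trmxK.
  have := boundl _ v^T; have := boundu _ v^T; rewrite e !ler_pM2r // => h1 h2.
  split=> //; rewrite -[s in X in _ /\ X]ger0_norm // -[s in X in X /\ _]ger0_norm //.
  by rewrite -!sqrtr_sqr; split; apply: ler_wsqrtr.
have [l0 lmem] := singular_value_mem evl.
have [u0 umem] := singular_value_mem evu.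
have minE : sigma_min Z = Num.sqrt l.
  apply/eqP; rewrite eq_le; apply/andP; split.
    by apply: ge_inf lmem; exists 0 => s /evbound[].
  by apply: lb_le_inf; [exists (Num.sqrt l) | move=> s /evbound[_ []]].
have maxE : sigma_max Z = Num.sqrt u.
  apply/eqP; rewrite eq_le; apply/andP; split.
    by apply: ge_sup; [exists (Num.sqrt u) | move=> s /evbound[_ []]].
  by apply: ub_le_sup umem; exists (Num.sqrt u) => s /evbound[_ []].
have lgt0 : 0 < l.
  rewrite lt0r l0 andbT; apply/eqP => lz; move: evl; rewrite lz.
  rewrite /eigenvalue /eigenspace raddf0 subr0 kermx_eq0 row_free_unit.
  by rewrite gram_unit rkZ eqxx.
split; first by rewrite minE sqrtr_gt0.
  by rewrite minE maxE; have [_ []] := evbound _ lmem.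
by move=> k V; rewrite minE maxE !sqr_sqrtr.
Qed.

End Spectral.

(** * Orthogonal projectors and tangent directions *)

Section Geometry.
Variable R : realType.

Lemma fdot_pythagoras m n (X Y : 'M[R]_(m, n)) :
  fdot X Y = 0 -> fdot (X + Y) (X + Y) = fdot X X + fdot Y Y.
Proof. by move=> o; rewrite fdotDl !fdotDr (fdotC Y X) o addr0 add0r. Qed.

Lemma proj_contract m n (P : 'M[R]_m) (X : 'M[R]_(m, n)) :
  P^T = P -> P *m P = P ->
  frobnorm (P *m X) <= frobnorm X /\ frobnorm (X - P *m X) <= frobnorm X.
Proof.
move=> PT PP.
have o : fdot (P *m X) (X - P *m X) = 0.
  by rewrite fdot_mull PT mulmxBr mulmxA PP subrr /fdot mulmx0 mxtrace0.
have e : fdot X X = fdot (P *m X) (P *m X) + fdot (X - P *m X) (X - P *m X).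
  by rewrite -fdot_pythagoras // addrC subrK.
by split; apply: frobnorm_le; rewrite ?frobnorm_ge0 // frobnorm_sqr e
  ?lerDl ?lerDr fdot_ge0.
Qed.

(** For [Z] of full column rank this is the Moore-Penrose inverse, and [Z *m pinv Z] is the
    orthogonal projector onto the range of [Z]. *)
Definition pinv m n (Z : 'M[R]_(m, n)) : 'M[R]_(n, m) :=
  invmx (Z^T *m Z) *m Z^T.

Section Pinv.
Variables (m n : nat) (Z : 'M[R]_(m, n)).
Hypothesis rkZ : \rank Z = n.

Lemma pinvK : pinv Z *m Z = 1%:M.
Proof. by rewrite /pinv -mulmxA mulVmx // gram_unit rkZ. Qed.

Lemma proj_tr : (Z *m pinv Z)^T = Z *m pinv Z.
Proof.
by rewrite /pinv !trmx_mul trmxK trmx_inv trmx_mul trmxK mulmxA.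
Qed.

Lemma proj_idem : (Z *m pinv Z) *m (Z *m pinv Z) = Z *m pinv Z.
Proof. by rewrite -mulmxA (mulmxA (pinv Z)) pinvK mul1mx. Qed.

Lemma pinv_proj (Q : 'M_(n, m)) : Q *m Z = 1%:M -> pinv Z = Q *m (Z *m pinv Z).
Proof. by move=> QZ; rewrite mulmxA QZ mul1mx. Qed.

(** [pinv Z] is [Q] followed on the right by an orthogonal projector, which cannot increase the
    norm. *)
Lemma frobnorm_pinv_le (Q : 'M_(n, m)) :
  Q *m Z = 1%:M -> frobnorm (pinv Z) <= frobnorm Q.
Proof.
move=> /pinv_proj ->; rewrite -frobnorm_tr trmx_mul proj_tr -(frobnorm_tr Q).
exact: (proj_contract _ proj_tr proj_idem).1.
Qed.

End Pinv.

Lemma left_inverse_rank m n (Z : 'M[R]_(m, n)) (Q : 'M_(n, m)) :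
  Q *m Z = 1%:M -> \rank Z = n.
Proof.
move=> QZ; apply/eqP; rewrite eqn_leq rank_leq_col.
by rewrite -{1}(mxrank1 R n) -QZ mxrankM_maxr.
Qed.

Section NearMinimizer.
Variables (p r : nat) (Z0 : 'M[R]_(p, r)) (s : R).
Hypotheses (rkZ0 : \rank Z0 = r) (s0 : 0 < s).
Hypothesis Z0_lower : forall k (V : 'M_(r, k)),
  s ^+ 2 * fdot V V <= fdot (Z0 *m V) (Z0 *m V).

Lemma frobnorm_mul_lower k (V : 'M_(r, k)) :
  s * frobnorm V <= frobnorm (Z0 *m V).
Proof.
rewrite -(@ler_pXn2r _ 2) ?nnegrE ?mulr_ge0 ?frobnorm_ge0 ?(ltW s0) //.
by rewrite exprMn !frobnorm_sqr.
Qed.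

Lemma frobnorm_pinv_mul k (X : 'M_(p, k)) :
  s * frobnorm (pinv Z0 *m X) <= frobnorm X.
Proof.
apply: le_trans (frobnorm_mul_lower _) _; rewrite mulmxA.
exact: (proj_contract _ (proj_tr Z0) (proj_idem rkZ0)).1.
Qed.

(* With [M = pinv Z0 *m Z], the matrix [M *m M^T] is within 1/2 of the
   identity, hence [M] is invertible and [invmx M *m pinv Z0] inverts [Z]. *)
Lemma near_left_inverse (Z : 'M[R]_(p, r)) :
  frobnorm (Z *m Z^T - Z0 *m Z0^T) <= s ^+ 2 / 2 ->
  exists2 Q : 'M[R]_(r, p), Q *m Z = 1%:M &
    frobnorm Q <= Num.sqrt (2 * r%:R) * frobnorm (pinv Z0).
Proof.
set D := _ - _ => Ds; set M := pinv Z0 *m Z.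
set F := pinv Z0 *m D *m (pinv Z0)^T.
have DT : D^T = D by rewrite /D linearB /= !trmx_mul !trmxK.
have ME : M *m M^T = 1%:M + F.
  have ZZ : Z *m Z^T = Z0 *m Z0^T + D by rewrite /D addrC subrK.
  rewrite /M trmx_mul mulmxA -(mulmxA (pinv Z0)) ZZ.
  rewrite mulmxDr mulmxDl (mulmxA (pinv Z0)) pinvK // mul1mx -/F.
  by rewrite -trmx_mul pinvK // trmx1.
(* Each factor [pinv Z0] costs [1 / s], so [|F| <= |D| / s^2]. *)
have F_le : frobnorm F <= 1 / 2.
  have h1 := frobnorm_pinv_mul (D *m (pinv Z0)^T).
  have h2 := frobnorm_pinv_mul D.
  move: h1; rewrite mulmxA -/F => h1.
  have h3 : frobnorm (D *m (pinv Z0)^T) = frobnorm (pinv Z0 *m D).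
    by rewrite -frobnorm_tr trmx_mul trmxK DT.
  rewrite h3 in h1.
  have : s ^+ 2 * frobnorm F <= s ^+ 2 * (1 / 2).
    by have := ler_wpM2l (ltW s0) h1; move: h2 Ds; rewrite !expr2; lra.
  by rewrite ler_pM2l // exprn_gt0.
(* From [|M^T W|^2 = |W|^2 + <W, F W>] and [|F| <= 1 / 2]. *)
have M_lower k (W : 'M_(r, k)) : fdot W W <= 2 * fdot (M^T *m W) (M^T *m W).
  rewrite [fdot (M^T *m W) _]fdot_mull trmxK mulmxA ME mulmxDl mul1mx fdotDr.
  have h1 := fdot_le W (- (F *m W)); rewrite fdotNr frobnormN in h1.
  have h2 := frobnormM F W; have h3 := frobnorm_ge0 W; have h4 := frobnorm_sqr W.
  have h5 : frobnorm F * frobnorm W <= 1 / 2 * frobnorm W by rewrite ler_wpM2r.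
  have h6 : frobnorm W * frobnorm (F *m W) <= frobnorm W * (1 / 2 * frobnorm W).
    by rewrite ler_wpM2l // (le_trans h2 h5).
  by move: h1 h4 h6; rewrite expr2; lra.
have Mu : M \in unitmx.
  rewrite -row_free_unit -kermx_eq0; apply/eqP/trmx_inj.
  rewrite trmx0; apply: fdot_eq0; apply/eqP; rewrite eq_le fdot_ge0 andbT.
  apply: le_trans (M_lower _ _) _.
  by rewrite -trmx_mul mulmx_ker trmx0 /fdot mulmx0 mxtrace0 mulr0.
exists (invmx M *m pinv Z0); first by rewrite -mulmxA mulVmx.
apply: le_trans (frobnormM _ _) _; apply: ler_wpM2r; first exact: frobnorm_ge0.
apply: frobnorm_le; first exact: sqrtr_ge0.
rewrite sqr_sqrtr ?mulr_ge0 ?ler0n //.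
(* Here [M^T W] is the identity, of squared norm [r]; hence the constant [2 * r]. *)
have := M_lower _ (invmx M^T); rewrite mulmxV ?unitmx_tr //.
by rewrite -trmx_inv fdot_tr {2}/fdot trmx1 mulmx1 mxtrace1.
Qed.

(* [E *m Z^T + Z *m E^T] is [D] compressed to the tangent space at [Z] of the
   matrices of rank [r]; the defect [N] is quadratic in [D] because it only sees
   the part of [Z0] orthogonal to the range of [Z]. *)
Lemma tangent_direction (Z : 'M[R]_(p, r)) (Q : 'M[R]_(r, p))
    (D := Z *m Z^T - Z0 *m Z0^T) :
  Q *m Z = 1%:M ->
  exists E B : 'M[R]_(p, r),
    [/\ Z *m E^T + E *m Z^T = D + B *m B^T,
        s ^+ 2 * frobnorm (B *m B^T) <= frobnorm D ^+ 2 &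
        frobnorm E <= 2 * frobnorm Q * frobnorm D].
Proof.
move=> QZ; have rkZ := left_inverse_rank QZ.
have DT : D^T = D by rewrite /D linearB /= !trmx_mul !trmxK.
set P := Z *m pinv Z.
have PT : P^T = P by exact: proj_tr.
have PP : P *m P = P by exact: proj_idem.
have PZ : P *m Z = Z by rewrite /P -mulmxA pinvK // mulmx1.
have ZP : Z^T *m P = Z^T by rewrite -PT -trmx_mul PZ.
have QZP : (pinv Z)^T *m Z^T = P by rewrite -trmx_mul -/P PT.
clearbody P.
(* Half of [P D P] is removed because the symmetrization would count this block twice. *)
pose E := D *m (pinv Z)^T - 2^-1 *: (P *m (D *m (pinv Z)^T)).
pose B := Z0 - P *m Z0.
(* [I - P] annihilates [Z Z^T], so in [D] it only sees [- Z0 Z0^T]. *)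
have BZ : B *m Z0^T = - (D - P *m D).
  rewrite /B /D mulmxBl mulmxBr [P *m (Z *m _)]mulmxA PZ.
  rewrite [P *m (Z0 *m _)]mulmxA opprB.
  by rewrite opprB [RHS]addrC addrA subrK.
clearbody D; exists E, B; split.
- have EZ : E *m Z^T = D *m P - 2^-1 *: (P *m D *m P).
    rewrite /E mulmxBl -scalemxAl -!mulmxA QZP.
    by rewrite mulmxA.
  have ZE : Z *m E^T = P *m D - 2^-1 *: (P *m D *m P).
    rewrite -[LHS]trmxK trmx_mul trmxK EZ linearB linearZ /=.
    by rewrite !trmx_mul !PT DT mulmxA.
  (* That is, [B B^T = - (I - P) D (I - P)], which turns [D] into [D P + P D - P D P]. *)
  have BB : B *m B^T = - (D - P *m D - (D - P *m D) *m P).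
    rewrite {2}/B linearB /= trmx_mul PT mulmxBr mulmxA BZ.
    by rewrite mulNmx opprK [RHS]opprB addrC.
  rewrite BB EZ ZE mulmxBl.
  move: (D *m P) (P *m D *m P) (P *m D) => X Y W.
  apply/matrixP => i j; rewrite !mxE.
  by lra.
(* The quadratic bound is the square of [s |B| <= |Z0 B^T| = |D - P D| <= |D|]. *)
- have h1 := frobnorm_mul_lower B^T.
  rewrite -[frobnorm (Z0 *m _)]frobnorm_tr trmx_mul trmxK BZ frobnormN in h1.
  have h2 := (proj_contract D PT PP).2.
  have h3 := frobnormM B B^T.
  have h4 := frobnorm_ge0 B.
  rewrite frobnorm_tr in h1 h3.
  have h5 : (s * frobnorm B) ^+ 2 <= frobnorm D ^+ 2.
    rewrite ler_pXn2r ?nnegrE ?mulr_ge0 ?frobnorm_ge0 ?(ltW s0) //.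
    exact: le_trans h1 h2.
  apply: le_trans h5; rewrite exprMn ler_pM2l ?exprn_gt0 //.
- have h1 := frobnormM D (pinv Z)^T; rewrite frobnorm_tr in h1.
  have h2 := (proj_contract (D *m (pinv Z)^T) PT PP).1.
  have h3 := frobnormD (D *m (pinv Z)^T) (- (2^-1 *: (P *m (D *m (pinv Z)^T)))).
  rewrite frobnormN frobnormZ ?invr_ge0 // -/E in h3.
  have h4 := frobnorm_pinv_le rkZ QZ.
  have h5 : frobnorm D * frobnorm (pinv Z) <= frobnorm D * frobnorm Q.
    by rewrite ler_wpM2l // frobnorm_ge0.
  have h6 := frobnorm_ge0 (D *m (pinv Z)^T).
  by lra.
Qed.

End NearMinimizer.
End Geometry.

(** * Derivatives of the objective *)

Section Objective.
Variables (R : realType) (p r m : nat) (A : {linear 'M[R]_p -> 'cV[R]_m}).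
Variable y : 'cV[R]_m.

(** The difference quotient is [q.[h]] for [h] nonzero, and polynomials are continuous. *)
Lemma directional_derivative_poly (V : normedModType R) (f : V -> R) (a v : V)
    (q : {poly R}) :
  (forall h, f (h *: v + a) = f a + h * q.[h]) -> 'D_v f a = q.[0].
Proof.
move=> fE; apply: cvg_lim => //.
have qc : (q.[h] @[h --> 0^'] --> q.[0])%classic.
  by apply/continuous_withinNx; exact: continuous_horner.
apply: cvg_trans qc; apply: near_eq_cvg; near=> h.
have h0 : h != 0 by near: h; exact: nbhs_dnbhs_neq.
by rewrite /= fE addrC addKr /GRing.scale /= mulKf.
Unshelve. all: by end_near.
Qed.

Implicit Types Z V H : 'M[R]_(p, r).

Lemma lr_objectiveE Z :
  lr_objective A y Z = fdot (A (Z *m Z^T) - y) (A (Z *m Z^T) - y).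
Proof. exact: frobnorm_sqr. Qed.

Lemma residual_line Z V (h : R) :
  A ((h *: V + Z) *m (h *: V + Z)^T) - y =
  A (Z *m Z^T) - y + h *: A (Z *m V^T + V *m Z^T) + h ^+ 2 *: A (V *m V^T).
Proof.
have -> : (h *: V + Z) *m (h *: V + Z)^T =
    Z *m Z^T + (h *: (Z *m V^T + V *m Z^T) + h ^+ 2 *: (V *m V^T)).
  have -> : (h *: V + Z)^T = h *: V^T + Z^T by rewrite linearD linearZ.
  rewrite mulmxDl !mulmxDr -!scalemxAl -!scalemxAr.
  move: (V *m V^T) (V *m Z^T) (Z *m V^T) (Z *m Z^T) => a b c d.
  by apply/matrixP => i j; rewrite !mxE; ring.
rewrite [A (_ + (_ + _))]linearD [A (_ + _ *: _)]linearD.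
by rewrite [A (h *: _)]linearZ [A (h ^+ 2 *: _)]linearZ -[RHS]addrA addrAC.
Qed.

Lemma derive_lr_objective Z V :
  'D_V (lr_objective A y) Z =
  2 * fdot (A (Z *m Z^T) - y) (A (Z *m V^T + V *m Z^T)).
Proof.
set u := A _ - y; set a := A _; set b := A (V *m V^T).
(* The expansion of [|u + h a + h^2 b|^2 - |u|^2], divided by [h], in Horner form. *)
pose q : {poly R} := (2 * fdot u a)%:P + 'X * ((fdot a a + 2 * fdot u b)%:P +
  'X * ((2 * fdot a b)%:P + 'X * (fdot b b)%:P)).
have -> : 2 * fdot u a = q.[0] by rewrite /q !hornerE.
apply: directional_derivative_poly => h.
rewrite !lr_objectiveE residual_line -/u -/a -/b /q !hornerE.
clear q; clearbody u a b.
rewrite !(fdotDl, fdotDr, fdotZl, fdotZr) (fdotC a u) (fdotC b u) (fdotC b a).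
ring.
Qed.

(** The directional derivative is linear in its direction, so expanding [H] over the [delta_mx i j]
    reduces it to the partial derivatives. *)
Lemma fdot_gradient Z H :
  fdot (gradient (lr_objective A y) Z) H =
  2 * fdot (A (Z *m Z^T) - y) (A (Z *m H^T + H *m Z^T)).
Proof.
set u := A _ - y.
pose c V := 2 * fdot u (A (Z *m V^T + V *m Z^T)).
have cD : {morph c : V W / V + W}.
  move=> V W; rewrite /c; have -> : (V + W)^T = V^T + W^T by exact: linearD.
  rewrite mulmxDr mulmxDl addrACA -mulrDr -fdotDr; congr (_ * fdot _ _).
  exact: linearD.
have cZ k V : c (k *: V) = k * c V.
  rewrite /c; have -> : (k *: V)^T = k *: V^T by exact: linearZ.
  rewrite -scalemxAr -scalemxAl -scalerDr [RHS]mulrCA -(fdotZr k).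
  by congr (_ * fdot _ _); exact: linearZ.
have c0 : c 0 = 0 by rewrite -(scale0r (0 : 'M_(p, r))) cZ mul0r.
rewrite -[RHS]/(c H) [in RHS](matrix_sum_delta H) fdotE (big_morph c cD c0).
apply: eq_bigr => i _; rewrite (big_morph c cD c0); apply: eq_bigr => j _.
by rewrite cZ mxE derive_lr_objective mulrC.
Qed.

End Objective.

(** * Polyak-Lojasiewicz inequality and decay along gradient descent *)

Section Convergence.
Variables (R : realType) (p r m : nat) (A : {linear 'M[R]_p -> 'cV[R]_m}).
Variables (gamma : R) (Z0 : 'M[R]_(p, r)) (s : R).
Hypotheses (gamma0 : 0 <= gamma) (gamma1 : gamma < 1).
Hypothesis hA : rip A gamma (2 * r).
Hypotheses (rkZ0 : \rank Z0 = r) (s0 : 0 < s).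
Hypothesis Z0_lower : forall k (V : 'M_(r, k)),
  s ^+ 2 * fdot V V <= fdot (Z0 *m V) (Z0 *m V).

Let g : 'M[R]_(p, r) -> R := lr_objective A (A (Z0 *m Z0^T)).
Let G := gradient g.
Let D (Z : 'M[R]_(p, r)) := Z *m Z^T - Z0 *m Z0^T.

(** The source of [2 * r] in the RIP: [D Z], [Z H^T + H Z^T] and, with a zero second term, [B B^T]
    all have this shape. *)
Lemma rank_mul_tr_add (X Y V W : 'M[R]_(p, r)) :
  (\rank (X *m Y^T + V *m W^T)%R <= 2 * r)%N.
Proof.
apply: leq_trans (mxrank_add _ _) _; rewrite mul2n -addnn.
by apply: leq_add; apply: leq_trans (mxrankM_maxl _ _) (rank_leq_col _).
Qed.

Lemma rip_sym (X Y V W : 'M[R]_(p, r)) (S := X *m Y^T + V *m W^T) : S^T = S ->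
  (1 - gamma) * frobnorm S ^+ 2 <= frobnorm (A S) ^+ 2 /\
  frobnorm (A S) ^+ 2 <= (1 + gamma) * frobnorm S ^+ 2.
Proof. by move=> ST; apply: hA => //; exact: rank_mul_tr_add. Qed.

(** Since [1 + gamma <= 2 ^+ 2]; this crude constant serves bounds that only limit the step size. *)
Lemma rip_le2 (X Y V W : 'M[R]_(p, r)) (S := X *m Y^T + V *m W^T) : S^T = S ->
  frobnorm (A S) <= 2 * frobnorm S.
Proof.
move=> /rip_sym[_ h]; have S0 := frobnorm_ge0 S.
rewrite -(@ler_pXn2r _ 2) ?nnegrE ?mulr_ge0 ?frobnorm_ge0 //.
apply: le_trans h _; rewrite exprMn; apply: ler_wpM2r; first exact: exprn_ge0.
by rewrite expr2; move: gamma1; lra.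
Qed.

Lemma rip_gram (B : 'M[R]_(p, r)) :
  frobnorm (A (B *m B^T)) ^+ 2 <= (1 + gamma) * frobnorm (B *m B^T) ^+ 2 /\
  frobnorm (A (B *m B^T)) <= 2 * frobnorm (B *m B^T).
Proof.
have e : B *m B^T = B *m B^T + 0 *m (0 : 'M_(p, r))^T by rewrite mul0mx addr0.
have sym : (B *m B^T + 0 *m (0 : 'M_(p, r))^T)^T = B *m B^T + 0 *m (0 : 'M_(p, r))^T.
  by rewrite -e trmx_mul trmxK.
by have [_] := rip_sym sym; have := rip_le2 sym; rewrite -e.
Qed.

Lemma objective_gapE Z : g Z = frobnorm (A (D Z)) ^+ 2.
Proof. by rewrite /g /lr_objective /D linearB. Qed.

Lemma gap_tr Z : (D Z)^T = D Z.
Proof. by rewrite /D linearB /= !trmx_mul !trmxK. Qed.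

Lemma gap_rip Z :
  (1 - gamma) * frobnorm (D Z) ^+ 2 <= g Z /\
  g Z <= (1 + gamma) * frobnorm (D Z) ^+ 2.
Proof.
have e : D Z = Z *m Z^T + (- Z0) *m Z0^T by rewrite mulNmx.
have sym : (Z *m Z^T + (- Z0) *m Z0^T)^T = Z *m Z^T + (- Z0) *m Z0^T.
  by rewrite -e gap_tr.
by rewrite objective_gapE e; exact: rip_sym sym.
Qed.

Lemma fdot_gradient_gap Z H :
  fdot (G Z) H = 2 * fdot (A (D Z)) (A (Z *m H^T + H *m Z^T)).
Proof. by rewrite /G /g fdot_gradient /D [in RHS]linearB. Qed.

(* Chosen so that on the sublevel set RIP bounds [|A N|] by [|A D| / 2], where
   [|N| <= |D|^2 / s^2] is the defect of [tangent_direction]. *)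
Definition basin_level := (1 - gamma) ^+ 2 * s ^+ 4 / (4 * (1 + gamma)).

Lemma gap_le_of_level Z : g Z <= basin_level ->
  (1 + gamma) * frobnorm (D Z) ^+ 2 <= (1 - gamma) * (s ^+ 4 / 4).
Proof.
move=> gZ; have [h _] := gap_rip Z.
have g1 : 0 < 1 + gamma by move: gamma0; lra.
have g2 : 0 < 1 - gamma by move: gamma1; lra.
have := ler_wpM2l (ltW g1) (le_trans h gZ).
have -> : (1 + gamma) * basin_level = (1 - gamma) * ((1 - gamma) * (s ^+ 4 / 4)).
  by rewrite /basin_level; field; rewrite gt_eqF.
by rewrite mulrCA (ler_pM2l g2).
Qed.

(** From [g <= <G, E> <= |G| K |D|] and [(1 - gamma) |D|^2 <= g], squaring and dividing by [g] gives
    the constant [(1 - gamma) / K^2]. *)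
Lemma gradient_dominates :
  exists2 mu : R, 0 < mu &
    forall Z, g Z <= basin_level -> mu * g Z <= frobnorm (G Z) ^+ 2.
Proof.
(* [K] exceeds [2 |Q|] uniformly in [Z], hence bounds [|E| / |D|]; the [+ 1] keeps it positive. *)
pose K := 2 * (Num.sqrt (2 * r%:R) * frobnorm (pinv Z0)) + 1.
have K0 : 0 < K by rewrite ltr_wpDl ?mulr_ge0 ?sqrtr_ge0 ?frobnorm_ge0.
have g2 : 0 < 1 - gamma by move: gamma1; lra.
exists ((1 - gamma) / K ^+ 2); first by rewrite divr_gt0 ?exprn_gt0.
move=> Z gZ; have [D_le _] := gap_rip Z; have level_le := gap_le_of_level gZ.
have D0 := frobnorm_ge0 (D Z); have s4 : 0 < s ^+ 4 by exact: exprn_gt0.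
have DD0 : 0 <= frobnorm (D Z) ^+ 2 by exact: exprn_ge0.
have D_small : frobnorm (D Z) <= s ^+ 2 / 2.
  rewrite -(@ler_pXn2r _ 2) ?nnegrE ?divr_ge0 ?exprn_ge0 ?(ltW s0) //.
  have -> : (s ^+ 2 / 2) ^+ 2 = s ^+ 4 / 4 by field.
  have : (1 + gamma) * frobnorm (D Z) ^+ 2 <= 1 * (s ^+ 4 / 4).
    by apply: le_trans level_le _; rewrite ler_wpM2r ?divr_ge0 ?(ltW s4) //;
       move: gamma0; lra.
  rewrite mul1r; apply: le_trans; rewrite ler_peMl //; move: gamma0; lra.
have [Q QZ Q_le] := near_left_inverse rkZ0 s0 Z0_lower D_small.
have [E [B [EB N_le E_le]]] := tangent_direction s0 Z0_lower QZ.
rewrite -/(D Z) in EB N_le E_le.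
set d := frobnorm (D Z) in D0 DD0 D_small D_le level_le N_le E_le.
set u := A (D Z); set N := B *m B^T in EB N_le.
have gu : g Z = frobnorm u ^+ 2 by rewrite objective_gapE.
have [AN2 _] := rip_gram B; rewrite -/N in AN2.
(* The chain is [|A N|^2 <= (1 + gamma) |D|^4 / s^4 <= (1 - gamma) |D|^2 / 4 <= g Z / 4]. *)
have AN : frobnorm (A N) <= frobnorm u / 2.
  rewrite -(@ler_pXn2r _ 2) ?nnegrE ?divr_ge0 ?frobnorm_ge0 //.
  rewrite -(ler_pM2l s4) expr_div_n -gu.
  have h1 : s ^+ 4 * frobnorm N ^+ 2 <= d ^+ 2 * d ^+ 2.
    have -> : s ^+ 4 * frobnorm N ^+ 2 = (s ^+ 2 * frobnorm N) ^+ 2 by ring.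
    rewrite -expr2 ler_pXn2r ?nnegrE ?mulr_ge0 ?frobnorm_ge0 ?exprn_ge0 ?(ltW s0) //.
  have h2 : s ^+ 4 * frobnorm (A N) ^+ 2 <= (1 + gamma) * (s ^+ 4 * frobnorm N ^+ 2).
    by rewrite [leRHS]mulrCA (ler_pM2l s4).
  apply: le_trans h2 _.
  have g1 : 0 <= 1 + gamma by move: gamma0; lra.
  apply: le_trans (ler_wpM2l g1 h1) _; rewrite mulrA.
  apply: le_trans (ler_wpM2r DD0 level_le) _.
  have -> : (1 - gamma) * (s ^+ 4 / 4) * d ^+ 2 = s ^+ 4 / 4 * ((1 - gamma) * d ^+ 2).
    by ring.
  have -> : s ^+ 4 * (g Z / 2 ^+ 2) = s ^+ 4 / 4 * g Z by field.
  by rewrite ler_wpM2l // divr_ge0 // ltW.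
have EK : frobnorm E <= K * d.
  apply: le_trans E_le _; apply: ler_wpM2r => //.
  by rewrite /K; move: Q_le; lra.
(* [<G, E> = 2 |u|^2 + 2 <u, A N>], and the last term is at least [- |u|^2]. *)
have gEle : g Z <= frobnorm (G Z) * frobnorm E.
  apply: le_trans (fdot_le _ _).
  rewrite fdot_gradient_gap EB [A (D Z + N)]linearD fdotDr -/u -/N.
  have h := fdot_le u (- A N); rewrite fdotNr frobnormN in h.
  have := ler_wpM2l (frobnorm_ge0 u) AN.
  by rewrite -frobnorm_sqr -gu mulrA -expr2 -gu; move: h; lra.
have gK : g Z <= frobnorm (G Z) * (K * d).
  by apply: le_trans gEle _; rewrite ler_wpM2l ?frobnorm_ge0.
have g0 : 0 <= g Z by rewrite gu exprn_ge0 ?frobnorm_ge0.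
have [->|gn0] := eqVneq (g Z) 0; first by rewrite mulr0 exprn_ge0 ?frobnorm_ge0.
have gpos : 0 < g Z by rewrite lt0r gn0.
rewrite mulrAC ler_pdivrMr ?exprn_gt0 // -(ler_pM2r gpos).
have := @ler_pXn2r _ 2 isT (g Z) (frobnorm (G Z) * (K * d)).
rewrite !nnegrE g0 !mulr_ge0 ?frobnorm_ge0 ?(ltW K0) // gK => /(_ isT isT) h.
have h1 : g Z ^+ 2 <= (frobnorm (G Z) * (K * d)) ^+ 2 by rewrite h.
apply: le_trans (_ : (1 - gamma) * ((frobnorm (G Z) * (K * d)) ^+ 2) <= _).
  by rewrite -mulrA -expr2 ler_pM2l.
have -> : (1 - gamma) * (frobnorm (G Z) * (K * d)) ^+ 2 =
  frobnorm (G Z) ^+ 2 * K ^+ 2 * ((1 - gamma) * d ^+ 2) by ring.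
by rewrite ler_wpM2l // mulr_ge0 ?exprn_ge0 ?frobnorm_ge0 // ltW.
Qed.

(* 808 = 2 * (4 + 20^2): the terms of order at least 2 in [tau] are at most
   [tau^2 (4 + 20^2) b^4 |G Z|^2]. *)
Lemma descent (b : R) : 1 <= b ->
  forall Z (tau : R), frobnorm Z <= b -> frobnorm (A (D Z)) <= b ->
  0 < tau -> tau <= 1 -> tau * (808 * b ^+ 4) <= 1 ->
  g (gd_step g tau Z) <= g Z - tau / 2 * frobnorm (G Z) ^+ 2.
Proof.
move=> b1 Z tau Zb ub t0 t1 tb.
have b0 : 0 <= b by move: b1; lra.
set q := frobnorm (G Z); have q0 : 0 <= q by exact: frobnorm_ge0.
set u := A (D Z) in ub.
(* The residual at [Z - tau G] is [u - tau a + tau^2 c]. *)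
set a := A (Z *m (G Z)^T + G Z *m Z^T); set c := A (G Z *m (G Z)^T).
have ua : q ^+ 2 = 2 * fdot u a by rewrite frobnorm_sqr fdot_gradient_gap.
have ZG_le : frobnorm (Z *m (G Z)^T) <= b * q.
  apply: le_trans (frobnormM _ _) _; rewrite frobnorm_tr.
  by rewrite ler_wpM2r.
have a_le : frobnorm a <= 4 * (b * q).
  have sym : (Z *m (G Z)^T + G Z *m Z^T)^T = Z *m (G Z)^T + G Z *m Z^T.
    by rewrite linearD /= !trmx_mul !trmxK addrC.
  have h := rip_le2 sym; rewrite -/a in h.
  have h1 := frobnormD (Z *m (G Z)^T) (G Z *m Z^T).
  rewrite -[frobnorm (G Z *m _)]frobnorm_tr trmx_mul trmxK in h1.
  by move: ZG_le h h1; lra.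
(* Cancel one [q] in [q^2 = 2 <u, a> <= 8 b^2 q]. *)
have q_le : q <= 8 * b ^+ 2.
  have [->|qn0] := eqVneq q 0; first by rewrite mulr_ge0 ?exprn_ge0.
  have qgt0 : 0 < q by rewrite lt0r qn0.
  rewrite -(ler_pM2r qgt0) -expr2 ua.
  have h := fdot_le u a.
  have : frobnorm u * frobnorm a <= b * (4 * (b * q)).
    by apply: ler_pM => //; exact: frobnorm_ge0.
  by rewrite expr2; move: h; lra.
have c_le : frobnorm c <= 2 * (q * q).
  apply: le_trans (rip_gram _).2 _; rewrite ler_pM2l //.
  by apply: le_trans (frobnormM _ _) _; rewrite frobnorm_tr.
have b2 : b <= b ^+ 2 by rewrite expr2 ler_peMr.
have bb0 : 0 <= b ^+ 2 by exact: exprn_ge0.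
have qq_le : q * q <= 8 * b ^+ 2 * q by rewrite ler_wpM2r.
(* [20 = 4 + 2 * 8]: [a] gives [4 b q <= 4 b^2 q], and [c] gives [2 q^2 <= 16 b^2 q]. *)
have w_le : frobnorm (a - tau *: c) <= 20 * b ^+ 2 * q.
  have := frobnormD a (- (tau *: c)); rewrite frobnormN frobnormZ ?(ltW t0) //.
  have h1 : tau * frobnorm c <= frobnorm c by rewrite ler_piMl ?frobnorm_ge0.
  have h2 : b * q <= b ^+ 2 * q by rewrite ler_wpM2r.
  by move: a_le c_le; lra.
have w2 : fdot (a - tau *: c) (a - tau *: c) <= 400 * b ^+ 4 * q ^+ 2.
  rewrite -frobnorm_sqr; have -> : 400 * b ^+ 4 * q ^+ 2 = (20 * b ^+ 2 * q) ^+ 2.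
    by ring.
  by rewrite ler_pXn2r ?nnegrE ?frobnorm_ge0 ?mulr_ge0.
have uc : 2 * fdot u c <= 4 * b ^+ 4 * q ^+ 2.
  have h := fdot_le u c.
  have h1 : frobnorm u * frobnorm c <= b * (2 * (q * q)).
    by apply: ler_pM => //; exact: frobnorm_ge0.
  have b4 : b <= b ^+ 4 by rewrite exprS ler_peMr // exprn_ege1.
  have := ler_wpM2r (exprn_ge0 2 q0) b4; move: h h1; rewrite !expr2; lra.
(* Grouped as [|u - tau (a - tau c)|^2]. The linear term is [- tau q^2], half of which pays for the
   remainder. *)
have -> : g (gd_step g tau Z) =
    fdot u u - 2 * tau * fdot u a +
    tau ^+ 2 * (2 * fdot u c + fdot (a - tau *: c) (a - tau *: c)).
  have -> : gd_step g tau Z = (- tau) *: G Z + Z.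
    by rewrite /gd_step addrC scaleNr.
  rewrite /g lr_objectiveE residual_line -/a -/c.
  have -> : A (Z *m Z^T) - A (Z0 *m Z0^T) = u by rewrite /u /D linearB.
  clearbody u a c.
  rewrite !(fdotDl, fdotDr, fdotZl, fdotZr, fdotNl, fdotNr).
  rewrite (fdotC a u) (fdotC c u) (fdotC c a).
  by ring.
rewrite objective_gapE -/u frobnorm_sqr.
have h : tau ^+ 2 * (2 * fdot u c + fdot (a - tau *: c) (a - tau *: c)) <=
         tau / 2 * q ^+ 2.
  apply: le_trans (_ : tau ^+ 2 * (404 * b ^+ 4 * q ^+ 2) <= _).
    by rewrite ler_wpM2l ?exprn_ge0 ?(ltW t0) //; move: uc w2; lra.
  have -> : tau ^+ 2 * (404 * b ^+ 4 * q ^+ 2) =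
    tau * (808 * b ^+ 4) * (tau / 2 * q ^+ 2) by field.
  by rewrite ler_piMl // mulr_ge0 ?exprn_ge0 ?divr_ge0 ?(ltW t0).
by have := congr1 (GRing.mul tau) ua; move: h; lra.
Qed.

(** Cauchy-Schwarz for [|Z|^2 = <I, Z Z^T>]. *)
Lemma frobnorm_sqr_gram (Z : 'M[R]_(p, r)) :
  frobnorm Z ^+ 2 <= frobnorm (1%:M : 'M[R]_p) * frobnorm (Z *m Z^T).
Proof.
apply: le_trans (fdot_le _ _).
by rewrite frobnorm_sqr /fdot trmx1 mul1mx mxtrace_mulC.
Qed.

(** Supplies the [b] of [descent]: the level bounds [D Z], hence [Z Z^T], hence [Z]. *)
Lemma level_bounded :
  exists2 b : R, 1 <= b & forall Z, g Z <= basin_level ->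
    frobnorm Z <= b /\ frobnorm (A (D Z)) <= b.
Proof.
(* Both [d] and [b] are at least 1, so that bounding a square by either one bounds the number
   itself. *)
pose d := s ^+ 4 + 1.
pose b := 1 + frobnorm (1%:M : 'M[R]_p) * (d + frobnorm (Z0 *m Z0^T)) + 2 * d.
have s4 : 0 <= s ^+ 4 by rewrite exprn_ge0 ?(ltW s0).
have d1 : 1 <= d by rewrite /d lerDr.
have I0 := frobnorm_ge0 (1%:M : 'M[R]_p); have X0 := frobnorm_ge0 (Z0 *m Z0^T).
have IX0 : 0 <= frobnorm (1%:M : 'M[R]_p) * (d + frobnorm (Z0 *m Z0^T)).
  by rewrite mulr_ge0 // addr_ge0 //; lra.
have b1 : 1 <= b by rewrite /b; lra.
exists b => // Z gZ.
have D0 := frobnorm_ge0 (D Z).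
have D2 : frobnorm (D Z) ^+ 2 <= d.
  have := gap_le_of_level gZ; rewrite /d.
  have := exprn_ge0 2 D0; set x := frobnorm (D Z) ^+ 2; set t := s ^+ 4 in s4 *.
  move: gamma0 gamma1 s4 => h1 h2 h3 h4 h5.
  have := mulr_ge0 h1 h4; have := mulr_ge0 h1 h3; lra.
have Dd : frobnorm (D Z) <= d.
  move: D2; rewrite expr2 => h; rewrite leNgt; apply/negP => dD.
  have : d * d < frobnorm (D Z) * frobnorm (D Z) by apply: ltr_pM => //; lra.
  have : d * 1 <= d * d by rewrite ler_wpM2l //; lra.
  by lra.
split.
  have h := frobnorm_sqr_gram Z.
  have h1 : frobnorm (Z *m Z^T) <= d + frobnorm (Z0 *m Z0^T).
    rewrite -[Z *m Z^T](subrK (Z0 *m Z0^T)) -/(D Z).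
    by apply: le_trans (frobnormD _ _) _; rewrite lerD2r.
  have h2 := ler_wpM2l I0 h1.
  have Zb : frobnorm Z ^+ 2 <= b by move: h h2; rewrite /b; lra.
  rewrite leNgt; apply/negP => bZ.
  have : b * b < frobnorm Z * frobnorm Z by apply: ltr_pM => //; lra.
  have : b * 1 <= b * b by rewrite ler_wpM2l //; lra.
  by move: Zb; rewrite expr2; lra.
have e : D Z = Z *m Z^T + (- Z0) *m Z0^T by rewrite mulNmx.
have := @rip_le2 Z Z (- Z0) Z0; rewrite -e => /(_ (gap_tr Z)).
by rewrite /b; lra.
Qed.

(** The ratio [(1 + c)^-1] is below 1 for every positive [c], so [c] needs no upper bound. *)
Lemma geometric_decay (u : nat -> R) (c : R) :
  0 < c -> (forall n, 0 <= u n) -> (forall n, u n.+1 * (1 + c) <= u n) ->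
  (u n @[n --> \oo] --> 0)%classic.
Proof.
move=> c0 u0 uS; pose z := (1 + c)^-1.
have c1 : 0 < 1 + c by lra.
have z0 : 0 < z by rewrite invr_gt0.
have zu n : u n <= geometric (u 0%N) z n.
  elim: n => [|n IHn]; first by rewrite /= expr0 mulr1.
  rewrite /= exprSr mulrA -ler_pdivrMr // invrK.
  exact: le_trans (uS n) IHn.
have gz : (geometric (u 0%N) z n @[n --> \oo] --> 0)%classic.
  apply: cvg_geometric; rewrite gtr0_norm // invf_lt1 //; lra.
apply: squeeze_cvgr (cvg_cst 0) gz.
by near=> n; rewrite u0 zu.
Unshelve. all: by end_near.
Qed.

Lemma gd_converges :
  exists2 tau0 : R, 0 < tau0 & forall tau, 0 < tau -> tau <= tau0 ->
    forall Zinit, g Zinit <= basin_level ->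
    (g (iter n (gd_step g tau) Zinit) @[n --> \oo] --> 0)%classic.
Proof.
have [mu mu0 dom] := gradient_dominates; have [b b1 bound] := level_bounded.
have b0 : 0 < 808 * b ^+ 4 by rewrite mulr_gt0 ?exprn_gt0 //; lra.
have b8 : 1 <= 808 * b ^+ 4.
  by rewrite mulr_ege1 ?exprn_ege1 // ler1n.
exists (808 * b ^+ 4)^-1; first by rewrite invr_gt0.
move=> tau t0 tt0 Zinit gZ.
have tb : tau * (808 * b ^+ 4) <= 1 by rewrite -ler_pdivlMr // mul1r.
have t1 : tau <= 1 by apply: le_trans tt0 _; rewrite invf_le1.
have g0 Z : 0 <= g Z by rewrite objective_gapE exprn_ge0 ?frobnorm_ge0.
pose Zn n := iter n (gd_step g tau) Zinit.
have step Z : g Z <= basin_level ->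
    g (gd_step g tau Z) <= g Z /\ g (gd_step g tau Z) * (1 + tau / 2 * mu) <= g Z.
  move=> gZl; have [Zb ub] := bound _ gZl.
  have h := descent b1 Zb ub t0 t1 tb.
  have t2 : 0 < tau / 2 by rewrite divr_gt0.
  have G0 : 0 <= frobnorm (G Z) ^+ 2 by rewrite exprn_ge0 ?frobnorm_ge0.
  have h1 : g (gd_step g tau Z) <= g Z.
    by have := mulr_ge0 (ltW t2) G0; lra.
  (* In the decrease [tau / 2 * mu * g Z], the value at [Z] is weakened to the next value, giving
     the multiplicative form. *)
  split=> //; have h2 := ler_wpM2l (ltW t2) (dom _ gZl).
  have h3 := ler_wpM2l (mulr_ge0 (ltW t2) (ltW mu0)) h1.
  by move: h h2 h3; lra.
have inv n : g (Zn n) <= basin_level.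
  by elim: n => // n IHn; apply: le_trans (step _ IHn).1 IHn.
apply: (@geometric_decay (g \o Zn) (tau / 2 * mu)).
- by rewrite mulr_gt0 ?divr_gt0.
- by move=> n; exact: g0.
- by move=> n; exact: (step _ (inv n)).2.
Qed.

End Convergence.

(** * From the orbit ball to the sublevel set *)

(** The strict bound on the infimum yields some [H], optimal or not. Put [E = Z H - Z0]; [Z Z^T] is
    unchanged by [H]. *)
Lemma orbit_ball_near (R : realType) (p r : nat) (Z0 Z : 'M[R]_(p, r)) (b : R) :
  orbit_ball Z0 b Z ->
  exists2 E : 'M[R]_(p, r), frobnorm E < b &
    Z *m Z^T - Z0 *m Z0^T = Z0 *m E^T + E *m Z0^T + E *m E^T.
Proof.
move=> /inf_lt[].
  exists (frobnorm (Z *m 1%:M - Z0)), 1%:M => //.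
  by rewrite /orthogonal_group /= trmx1 mul1mx.
move=> _ [H HH <-] Hb; exists (Z *m H - Z0) => //.
have ZH : Z *m Z^T = (Z *m H) *m (Z *m H)^T.
  by rewrite trmx_mul mulmxA -(mulmxA Z) (mulmx1C HH) mulmx1.
rewrite ZH; set V := Z *m H.
have -> : (V - Z0)^T = V^T - Z0^T by exact: linearB.
rewrite !(mulmxBl, mulmxBr).
move: (V *m V^T) (Z0 *m V^T) (V *m Z0^T) (Z0 *m Z0^T) => a c d e.
by apply/matrixP => i j; rewrite !mxE; ring.
Qed.

Lemma orbit_ball_center (R : realType) (p r : nat) (Z0 : 'M[R]_(p, r)) (b : R) :
  0 < b -> orbit_ball Z0 b Z0.
Proof.
apply: le_lt_trans; apply: ge_inf; first by exists 0 => _ [H _ <-]; exact: frobnorm_ge0.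
exists 1%:M; first by rewrite /orthogonal_group /= trmx1 mul1mx.
rewrite mulmx1 subrr; apply/eqP; rewrite eq_le frobnorm_ge0 andbT.
by apply: frobnorm_le => //; rewrite /fdot mulmx0 mxtrace0 expr0n.
Qed.

(** With [k = (1 - gamma) / (1 + gamma)], [S b = k s^2 / 8] and [b <= S]. So
    [2 S b + b^2 <= 3 S b <= k s^2 / 2], while [basin_level] is [(1 + gamma) (k s^2 / 2)^2]. *)
Lemma beta_LR_level (R : realType) (gamma s S b : R) :
  0 <= gamma -> gamma < 1 -> 0 < s -> s <= S ->
  b = 1 / 8 * ((1 - gamma) * s ^+ 2 / ((1 + gamma) * S)) ->
  0 < b /\ (1 + gamma) * (2 * S * b + b ^+ 2) ^+ 2 <= basin_level gamma s.
Proof.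
move=> h0 h1 s0 sS ->; set k := (1 - gamma) / (1 + gamma).
have S0 : 0 < S by exact: lt_le_trans sS.
have g1 : 0 < 1 + gamma by lra.
have k0 : 0 < k by rewrite divr_gt0 // subr_gt0.
have k1 : k <= 1 by rewrite ler_pdivrMr // mul1r; lra.
have -> : 1 / 8 * ((1 - gamma) * s ^+ 2 / ((1 + gamma) * S)) = k * s ^+ 2 / (8 * S).
  by rewrite /k; field; rewrite !gt_eqF.
set c := k * s ^+ 2 / (8 * S).
have s2 : 0 < s ^+ 2 by exact: exprn_gt0.
have c0 : 0 < c by apply: divr_gt0; [exact: mulr_gt0 | rewrite mulr_gt0].
have SC : S * c = k * s ^+ 2 / 8 by rewrite /c; field; rewrite gt_eqF.
split=> //.
have cS : c <= S.
  rewrite -(ler_pM2l S0) SC.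
  have : s ^+ 2 <= S * S by rewrite expr2 ler_pM // ltW.
  have : k * s ^+ 2 <= 1 * s ^+ 2 by rewrite ler_pM2r.
  by move: s2; lra.
have le2 : 2 * S * c + c ^+ 2 <= k * s ^+ 2 / 2.
  have : c * c <= S * c by rewrite ler_pM2r.
  by rewrite (expr2 c) -mulrA SC; move: (mulr_gt0 k0 s2); lra.
have -> : basin_level gamma s = (1 + gamma) * (k * s ^+ 2 / 2) ^+ 2.
  by rewrite /basin_level /k; field; rewrite gt_eqF.
have Sc0 : 0 < S * c by rewrite SC divr_gt0 // mulr_gt0.
have cc0 := sqr_ge0 c.
have lhs0 : 0 <= 2 * S * c + c ^+ 2 by lra.
by rewrite ler_pM2l // ler_pXn2r ?nnegrE // (le_trans lhs0).
Qed.

(** [x0] factors as [W W^T] with [r] columns, so the minimum is 0, and the lower RIP bound at [Z0]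
    makes the gap vanish. *)
Lemma lr_minimizer_gram (R : realType) (p r m : nat)
    (A : {linear 'M[R]_p -> 'cV[R]_m}) (gamma : R) (x0 : 'M[R]_p)
    (Z0 : 'M[R]_(p, r)) :
  gamma < 1 -> rip A gamma (2 * r) -> psdmx x0 -> (\rank x0 <= r)%N ->
  (forall Z : 'M[R]_(p, r), lr_objective A (A x0) Z0 <= lr_objective A (A x0) Z) ->
  x0 = Z0 *m Z0^T.
Proof.
move=> h1 hA hx0 hx0r hZ0; have [W xW] := psdmx_factor hx0 hx0r.
have := hZ0 W; rewrite xW => gZ0.
have [h _] := gap_rip W hA Z0.
have gW : lr_objective A (A (W *m W^T)) W = 0.
  by rewrite lr_objectiveE subrr /fdot mulmx0 mxtrace0.
apply/esym/eqP; rewrite -subr_eq0; apply/eqP/fdot_eq0/eqP.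
rewrite eq_le fdot_ge0 andbT -frobnorm_sqr.
have g2 : 0 < 1 - gamma by lra.
by rewrite -(pmulr_rle0 _ g2) -gW; apply: le_trans gZ0.
Qed.

Theorem theorem3p1 (R : realType) (p r m : nat)
    (hp : (0 < p)%N) (hr : (0 < r)%N) (hm : (0 < m)%N)
    (A : {linear 'M[R]_p -> 'cV[R]_m})
    (gamma : R) (hgamma0 : 0 <= gamma) (hgamma1 : gamma < 1)
    (hA : rip A gamma (2 * r))
    (x0 : 'M[R]_p) (hx0 : psdmx x0) (hx0r : (\rank x0 <= r)%N)
    (y : 'cV[R]_m) (hy : y = A x0)
    (Z0 : 'M[R]_(p, r)) (hZ0r : \rank Z0 = r)
    (hZ0 : forall Z : 'M[R]_(p, r), lr_objective A y Z0 <= lr_objective A y Z) :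
  basin_of_attraction (lr_objective A y) Z0 (orbit_ball Z0 (beta_LR gamma Z0)).
Proof.
move: hZ0; rewrite hy => hZ0.
have x0E := lr_minimizer_gram hgamma1 hA hx0 hx0r hZ0.
rewrite x0E {hZ0 hy}.
have [smin_gt0 smin_le bounds] := singular_values_bounds hr hZ0r.
set s := sigma_min Z0 in smin_gt0 smin_le bounds.
set S := sigma_max Z0 in smin_le bounds.
have lower k (V : 'M_(r, k)) := (bounds k V).1.
have [b_gt0 b_level] :=
  beta_LR_level hgamma0 hgamma1 smin_gt0 smin_le (erefl (beta_LR gamma Z0)).
set b := beta_LR gamma Z0 in b_gt0 b_level *.
split; first exact: orbit_ball_center.
have [tau0 tau0_gt0 conv] :=
  gd_converges hgamma0 hgamma1 hA hZ0r smin_gt0 lower.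
exists tau0; split=> // tau tau_gt0 tau_le Zinit /orbit_ball_near[E Eb DE].
have -> : lr_objective A (A (Z0 *m Z0^T)) Z0 = 0.
  by rewrite lr_objectiveE subrr /fdot mulmx0 mxtrace0.
apply: conv => //.
(* The upper RIP bound reduces the claim to [|D| <= 2 S b + b^2]: as [|E| < b], the two linear terms
   of [D] give [2 S b] and the quadratic one [b^2]. *)
apply: le_trans (gap_rip Z0 hA Zinit).2 _; apply: le_trans b_level.
have g1 : 0 < 1 + gamma by lra.
have S0 : 0 <= S by apply: le_trans smin_le; exact: ltW.
have E0 := frobnorm_ge0 E.
rewrite ler_pM2l // ler_pXn2r ?nnegrE ?frobnorm_ge0 //; last first.
  by have := mulr_ge0 S0 (ltW b_gt0); have := sqr_ge0 b; lra.
have ZE : frobnorm (Z0 *m E^T) <= S * frobnorm E.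
  apply: frobnorm_le; first by rewrite mulr_ge0.
  by rewrite exprMn frobnorm_sqr -(fdot_tr E); exact: (bounds _ _).2.
have EZ : frobnorm (E *m Z0^T) <= S * frobnorm E.
  by rewrite -frobnorm_tr trmx_mul trmxK.
have EE := frobnormM E E^T; rewrite frobnorm_tr in EE.
rewrite DE; apply: le_trans (frobnormD _ _) _.
have h := frobnormD (Z0 *m E^T) (E *m Z0^T).
have h2 : frobnorm E * frobnorm E <= b * b by rewrite ler_pM // ltW.
have h3 : S * frobnorm E <= S * b by rewrite ler_wpM2l // ltW.
by rewrite (expr2 b); lra.
Qed.
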